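(* The theory $\mathbf{PA}^2$ (full classical second-order arithmetic) can be interpreted within $\mathbf{HA}^\omega + \mathbf{iRC!}_{\mathbf{N},\mathbf{N}} + \mathbf{LEM}$, which is then impredicative and incompatible with Weyl's predicativity.
   Context: Finite types: $\mathbf{N}$ is a finite type, and if $\sigma,\tau$ are finite types then so are $\sigma\to\tau$ and $\sigma\times\tau$. $\mathbf{HA}^\omega$ (Heyting arithmetic in all finite types) is the many-sorted intuitionistic theory with countably infinitely many variables $x^\sigma,y^\sigma,\dots$ for each finite type $\sigma$, an equality predicate $=_\sigma$ for each type, application operators, and constants for zero, successor, recursor, pairing, projections, and the combinators $\mathbf{k}$ and $\mathbf{s}$. Its axioms are those of many-sorted intuitionistic predicate logic with equality, congruence rules for equality, the usual axioms for zero and successor with the induction scheme, and the defining conditions of the constants. Logical implication is written $\supset$. $\exists! y^\tau\,\phi(x,y)$ abbreviates $\exists y^\tau\phi(x,y)\land\forall y_1^\tau\forall y_2^\tau(\phi(x,y_1)\land\phi(x,y_2)\supset y_1=_\tau y_2)$. $\mathbf{iRC!}_{\mathbf{N},\mathbf{N}}$ is the internal number-theoretic rule of unique choice, formulated for $\mathbf{HA}^\omega$ as follows: if $\mathbf{HA}^\omega\vdash\forall x^{\mathbf{N}}\exists! y^{\mathbf{N}}\,\phi(x,y)$, then $\mathbf{HA}^\omega\vdash\exists f^{\mathbf{N}\to\mathbf{N}}\forall x^{\mathbf{N}}\,\phi(x,fx)$. $\mathbf{LEM}$ is the law of excluded middle $\phi\lor\neg\phi$ for all formulas $\phi$. $\mathbf{HA}^\omega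 + \mathbf{iRC!}_{\mathbf{N},\mathbf{N}} + \mathbf{LEM}$ is $\mathbf{HA}^\omega$ extended with this rule and with $\mathbf{LEM}$; in this extension the rule is used also on premises derived with the help of $\mathbf{LEM}$. $\mathbf{PA}^2$ is classical second-order arithmetic: the language of $\mathbf{PA}$ extended by a second sort of variables $X,Y,\dots$ for sets of natural numbers and atomic formulas $t\in X$, with the second-order induction axiom and the full comprehension scheme for sets of natural numbers. It can equally be formulated in a language with typed primitive function symbols, with first-order variables interpreted as variables of type $\mathbf{N}$, second-order variables interpreted by their characteristic functions of type $\mathbf{N}\to\mathbf{N}$, and $t\in X$ interpreted as $X(t)=1$; comprehension is then $\exists f^{\mathbf{N}\to\mathbf{N}}\forall x^{\mathbf{N}}(fx=1\Leftrightarrow\phi(x))$ for arbitrary formulas $\phi$ in which $f$ does not occur free. $\mathbf{PA}^2$ is an impredicative theory. ''Weyl's predicativity'' refers informally to the classical predicative conception of mathematics of Weyl's Das Kontinuum, in which the power of a set and the real numbers are not sets and one may not define new sets by quantifying over them. *)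

(* Defs.v *)
From Stdlib Require Import List.
Import ListNotations.

Set Implicit Arguments.

(** * Many-sorted first-order logic

    Terms and formulas are intrinsically typed: they live over a context, the
    finite list of the sorts of the variables that may occur free, the most
    recently bound one first.  Bound variables are de Bruijn indices, so that
    substitution is capture-avoiding by construction and "does not occur free"
    is expressed by weakening. *)

Inductive var {S : Type} : list S -> S -> Type :=
| VZ : forall s G, var (s :: G) s
| VS : forall s t G, var G s -> var (t :: G) s.
Arguments VZ {S s G}.
Arguments VS {S s t G} _.

Record language := Language {
  sort : Type;
  term : list sort -> sort -> Type;
  atom : list sort -> Type;
  tvar : forall G s, var G s -> term G s;
  tsubst : forall G D, (forall s, var G s -> term D s) ->
             forall s, term G s -> term D s;
  asubst : forall G D, (forall s, var G s -> term D s) -> atom G -> atom D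
}.
Arguments term : clear implicits.
Arguments atom : clear implicits.
Arguments tvar _ {G s} _.
Arguments tsubst _ {G D} _ {s} _.
Arguments asubst _ {G D} _ _.

Inductive form (L : language) (G : list (sort L)) : Type :=
| Atom : atom L G -> form L G
| Bot : form L G
| And : form L G -> form L G -> form L G
| Or : form L G -> form L G -> form L G
| Imp : form L G -> form L G -> form L G
| All : forall s, form L (s :: G) -> form L G
| Ex : forall s, form L (s :: G) -> form L G.
Arguments form : clear implicits.
Arguments Atom {L G} _.
Arguments Bot {L G}.
Arguments And {L G} _ _.
Arguments Or {L G} _ _.
Arguments Imp {L G} _ _.
Arguments All {L G} s _.
Arguments Ex {L G} s _.

Definition Not {L G} (A : form L G) : form L G := Imp A Bot.
Definition Iff {L G} (A B : form L G) : form L G := And (Imp A B) (Imp B A).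

Section Substitution.
  Context {L : language}.

  Definition sub (G D : list (sort L)) : Type :=
    forall s, var G s -> term L D s.

  Definition ids {G} : sub G G := fun s v => tvar L v.

  Definition shift {G} {t : sort L} : sub G (t :: G) :=
    fun s v => tvar L (VS v).

  Definition scons {G D} {t : sort L} (u : term L D t) (f : sub G D) :
    sub (t :: G) D :=
    fun s v =>
      match v in var G' s' return
        match G' with
        | [] => unit
        | t' :: G0 => term L D t' -> sub G0 D -> term L D s'
        end
      with
      | VZ => fun u _ => u
      | VS w => fun _ f => f _ w
      end u f.

  Definition up {G D} {t : sort L} (f : sub G D) : sub (t :: G) (t :: D) :=
    scons (tvar L VZ) (fun s v => tsubst L shift (f s v)).

  Fixpoint subst {G D} (f : sub G D) (A : form L G) : form L D :=
    match A in form _ _ return form L D with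
    | Atom a => Atom (asubst L f a)
    | Bot => Bot
    | And A B => And (subst f A) (subst f B)
    | Or A B => Or (subst f A) (subst f B)
    | Imp A B => Imp (subst f A) (subst f B)
    | All s A => All s (subst (up f) A)
    | Ex s A => Ex s (subst (up f) A)
    end.

  Definition wk {G} {t : sort L} (A : form L G) : form L (t :: G) :=
    subst shift A.

  Definition inst {G} {t : sort L} (A : form L (t :: G)) (u : term L G t) :
    form L G := subst (scons u ids) A.
End Substitution.

(** A theory has axioms and, besides the rules of logic, one-premise rules on
    theorems: [rule T A B] allows to infer [B] once [A] has been proved without
    open assumptions. *)
Record theory (L : language) := Theory {
  axiom : forall G, form L G -> Prop;
  rule : forall G, form L G -> form L G -> Prop
}.
Arguments axiom {L} _ {G} _.
Arguments rule {L} _ {G} _ _.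

(** Intuitionistic natural deduction. *)
Inductive proves {L : language} (T : theory L) (G : list (sort L)) :
  list (form L G) -> form L G -> Prop :=
| PHyp : forall H A, In A H -> proves T H A
| PAxiom : forall H A, axiom T A -> proves T H A
| PRule : forall H A B, rule T A B -> proves T [] A -> proves T H B
| PBotE : forall H A, proves T H Bot -> proves T H A
| PAndI : forall H A B, proves T H A -> proves T H B -> proves T H (And A B)
| PAndE1 : forall H A B, proves T H (And A B) -> proves T H A
| PAndE2 : forall H A B, proves T H (And A B) -> proves T H B
| POrI1 : forall H A B, proves T H A -> proves T H (Or A B)
| POrI2 : forall H A B, proves T H B -> proves T H (Or A B)
| POrE : forall H A B C, proves T H (Or A B) ->
    proves T (A :: H) C -> proves T (B :: H) C -> proves T H C
| PImpI : forall H A B, proves T (A :: H) B -> proves T H (Imp A B)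
| PImpE : forall H A B, proves T H (Imp A B) -> proves T H A -> proves T H B
| PAllI : forall H s (A : form L (s :: G)),
    proves T (map wk H) A -> proves T H (All s A)
| PAllE : forall H s (A : form L (s :: G)) (u : term L G s),
    proves T H (All s A) -> proves T H (inst A u)
| PExI : forall H s (A : form L (s :: G)) (u : term L G s),
    proves T H (inst A u) -> proves T H (Ex s A)
| PExE : forall H s (A : form L (s :: G)) C, proves T H (Ex s A) ->
    proves T (A :: map wk H) (wk C) -> proves T H C.

Definition theorem_of {L : language} (T : theory L) {G : list (sort L)}
  (A : form L G) : Prop := proves T [] A.

(** * Heyting arithmetic in all finite types *)

Inductive ty : Type :=
| N : ty
| Arr : ty -> ty -> ty
| Prod : ty -> ty -> ty.
Infix "~>" := Arr (at level 60, right associativity).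
Infix "**" := Prod (at level 50, left associativity).

Inductive const : ty -> Type :=
| CZero : const N
| CSucc : const (N ~> N)
| CRec : forall s, const (s ~> (s ~> N ~> s) ~> N ~> s)
| CPair : forall s t, const (s ~> t ~> s ** t)
| CFst : forall s t, const (s ** t ~> s)
| CSnd : forall s t, const (s ** t ~> t)
| CK : forall s t, const (s ~> t ~> s)
| CS : forall r s t, const ((r ~> s ~> t) ~> (r ~> s) ~> r ~> t).

Inductive hterm (G : list ty) : ty -> Type :=
| HVar : forall s, var G s -> hterm G s
| HConst : forall s, const s -> hterm G s
| HApp : forall s t, hterm G (s ~> t) -> hterm G s -> hterm G t.
Arguments HVar {G s} _.
Arguments HConst {G s} _.
Arguments HApp {G s t} _ _.
Infix "@@" := HApp (at level 40, left associativity).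

Inductive hatom (G : list ty) : Type :=
| HEq : forall s, hterm G s -> hterm G s -> hatom G.
Arguments HEq {G s} _ _.

Fixpoint hsubst {G D : list ty} (f : forall s, var G s -> hterm D s) {s}
  (u : hterm G s) : hterm D s :=
  match u in hterm _ s return hterm D s with
  | HVar v => f _ v
  | HConst c => HConst c
  | HApp a b => HApp (hsubst f a) (hsubst f b)
  end.

Definition hasubst {G D : list ty} (f : forall s, var G s -> hterm D s)
  (a : hatom G) : hatom D :=
  match a with HEq u v => HEq (hsubst f u) (hsubst f v) end.

Canonical Structure HAL : language :=
  {| sort := ty; term := hterm; atom := hatom; tvar := @HVar;
     tsubst := @hsubst; asubst := @hasubst |}.

Notation hform := (form HAL).

Section HeytingArithmetic.
  Context {G : list ty}.

  Definition Eq {s} (u v : hterm G s) : hform G := Atom (L := HAL) (HEq u v).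

  Definition hzero : hterm G N := HConst CZero.
  Definition hsucc (u : hterm G N) : hterm G N := HConst CSucc @@ u.
  Definition hone : hterm G N := hsucc hzero.
  Definition hrec {s} (a : hterm G s) (b : hterm G (s ~> N ~> s))
    (u : hterm G N) : hterm G s := HConst (CRec s) @@ a @@ b @@ u.
  Definition hpair {s t} (a : hterm G s) (b : hterm G t) : hterm G (s ** t) :=
    HConst (CPair s t) @@ a @@ b.
  Definition hfst {s t} (p : hterm G (s ** t)) : hterm G s :=
    HConst (CFst s t) @@ p.
  Definition hsnd {s t} (p : hterm G (s ** t)) : hterm G t :=
    HConst (CSnd s t) @@ p.
End HeytingArithmetic.

Inductive HA_axiom (G : list ty) : hform G -> Prop :=
| HA_refl : forall s (u : hterm G s), HA_axiom (Eq u u)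
| HA_sym : forall s (u v : hterm G s), HA_axiom (Imp (Eq u v) (Eq v u))
| HA_trans : forall s (u v w : hterm G s),
    HA_axiom (Imp (Eq u v) (Imp (Eq v w) (Eq u w)))
| HA_congr : forall s t (f g : hterm G (s ~> t)) (u v : hterm G s),
    HA_axiom (Imp (Eq f g) (Imp (Eq u v) (Eq (f @@ u) (g @@ v))))
| HA_succ_zero : forall u : hterm G N, HA_axiom (Not (Eq (hsucc u) hzero))
| HA_succ_inj : forall u v : hterm G N,
    HA_axiom (Imp (Eq (hsucc u) (hsucc v)) (Eq u v))
| HA_induction : forall A : hform (N :: G),
    HA_axiom
      (Imp (inst A hzero)
         (Imp (All N
                 (Imp A (subst
                           (scons (hsucc (HVar VZ)) shift) A)))
            (All N A)))
| HA_rec_zero : forall s (a : hterm G s) (b : hterm G (s ~> N ~> s)),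
    HA_axiom (Eq (hrec a b hzero) a)
| HA_rec_succ : forall s (a : hterm G s) (b : hterm G (s ~> N ~> s))
    (u : hterm G N),
    HA_axiom (Eq (hrec a b (hsucc u)) (b @@ hrec a b u @@ u))
| HA_fst : forall s t (a : hterm G s) (b : hterm G t),
    HA_axiom (Eq (hfst (hpair a b)) a)
| HA_snd : forall s t (a : hterm G s) (b : hterm G t),
    HA_axiom (Eq (hsnd (hpair a b)) b)
| HA_pair : forall s t (p : hterm G (s ** t)),
    HA_axiom (Eq (hpair (hfst p) (hsnd p)) p)
| HA_k : forall s t (a : hterm G s) (b : hterm G t),
    HA_axiom (Eq (HConst (CK s t) @@ a @@ b) a)
| HA_s : forall r s t (a : hterm G (r ~> s ~> t)) (b : hterm G (r ~> s))
    (c : hterm G r),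
    HA_axiom (Eq (HConst (CS r s t) @@ a @@ b @@ c) (a @@ c @@ (b @@ c))).

Definition HAomega : theory HAL :=
  {| axiom := HA_axiom; rule := fun _ _ _ => False |}.

(** [exists! y^t. A], with [y] the variable of index 0 of [A]; under the two
    universal quantifiers [y1] and [y2] have indices 1 and 0. *)
Definition ExUnique {G : list ty} (t : ty) (A : hform (t :: G)) : hform G :=
  let weak2 : sub G (t :: t :: G) := fun s v => HVar (VS (VS v)) in
  And (Ex t A)
    (All t (All t
       (Imp (And (subst (scons (HVar (VS VZ)) weak2) A)
                 (subst (scons (HVar VZ) weak2) A))
            (Eq (HVar (VS VZ)) (HVar VZ))))).

(** The rule iRC!_{N,N}.  In [A], [y] has index 0 and [x] has index 1, the other
    variables being parameters; in the body of the conclusion [x] has index 0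
    and [f] has index 1. *)
Inductive iRC_rule (G : list ty) : hform G -> hform G -> Prop :=
| iRC_intro : forall A : hform (N :: N :: G),
    iRC_rule
      (All N (ExUnique A))
      (Ex (N ~> N) (All N
         (subst
            (scons (HVar (VS VZ) @@ HVar VZ)
               (scons (HVar VZ)
                  (fun s v => HVar (VS (VS v)))))
            A))).

Inductive LEM_axiom {L : language} (G : list (sort L)) : form L G -> Prop :=
| LEM_intro : forall A : form L G, LEM_axiom (Or A (Not A)).

Definition HAomega_iRC_LEM : theory HAL :=
  {| axiom := fun G A => HA_axiom A \/ LEM_axiom A; rule := iRC_rule |}.

(** * Classical second-order arithmetic *)

Inductive psort : Type := Num | Set_.

Inductive pterm (G : list psort) : psort -> Type :=
| PVar : forall s, var G s -> pterm G s
| PZero : pterm G Num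
| PSucc : pterm G Num -> pterm G Num
| PPlus : pterm G Num -> pterm G Num -> pterm G Num
| PMult : pterm G Num -> pterm G Num -> pterm G Num.
Arguments PVar {G s} _.
Arguments PZero {G}.
Arguments PSucc {G} _.
Arguments PPlus {G} _ _.
Arguments PMult {G} _ _.

Inductive patom (G : list psort) : Type :=
| PEq : pterm G Num -> pterm G Num -> patom G
| PIn : pterm G Num -> pterm G Set_ -> patom G.
Arguments PEq {G} _ _.
Arguments PIn {G} _ _.

Fixpoint psubst {G D : list psort} (f : forall s, var G s -> pterm D s) {s}
  (u : pterm G s) : pterm D s :=
  match u in pterm _ s return pterm D s with
  | PVar v => f _ v
  | PZero => PZero
  | PSucc a => PSucc (psubst f a)
  | PPlus a b => PPlus (psubst f a) (psubst f b)
  | PMult a b => PMult (psubst f a) (psubst f b)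
  end.

Definition pasubst {G D : list psort} (f : forall s, var G s -> pterm D s)
  (a : patom G) : patom D :=
  match a with
  | PEq u v => PEq (psubst f u) (psubst f v)
  | PIn u X => PIn (psubst f u) (psubst f X)
  end.

Canonical Structure PAL : language :=
  {| sort := psort; term := pterm; atom := patom; tvar := @PVar;
     tsubst := @psubst; asubst := @pasubst |}.

Notation pform := (form PAL).

Definition peq {G : list psort} (u v : pterm G Num) : pform G :=
  Atom (L := PAL) (PEq u v).
Definition pin {G : list psort} (u : pterm G Num) (X : pterm G Set_) : pform G :=
  Atom (L := PAL) (PIn u X).

Inductive PA2_axiom (G : list psort) : pform G -> Prop :=
| PA2_refl : forall u, PA2_axiom (peq u u)
| PA2_sym : forall u v : pterm G Num, PA2_axiom (Imp (peq u v) (peq v u))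
| PA2_trans : forall u v w : pterm G Num,
    PA2_axiom (Imp (peq u v) (Imp (peq v w) (peq u w)))
| PA2_congr_succ : forall u v : pterm G Num,
    PA2_axiom (Imp (peq u v) (peq (PSucc u) (PSucc v)))
| PA2_congr_plus : forall u u' v v' : pterm G Num,
    PA2_axiom (Imp (peq u u') (Imp (peq v v') (peq (PPlus u v) (PPlus u' v'))))
| PA2_congr_mult : forall u u' v v' : pterm G Num,
    PA2_axiom (Imp (peq u u') (Imp (peq v v') (peq (PMult u v) (PMult u' v'))))
| PA2_congr_in : forall (u v : pterm G Num) (X : pterm G Set_),
    PA2_axiom (Imp (peq u v) (Imp (pin u X) (pin v X)))
| PA2_succ_zero : forall u : pterm G Num, PA2_axiom (Not (peq (PSucc u) PZero))
| PA2_succ_inj : forall u v : pterm G Num,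
    PA2_axiom (Imp (peq (PSucc u) (PSucc v)) (peq u v))
| PA2_plus_zero : forall u : pterm G Num, PA2_axiom (peq (PPlus u PZero) u)
| PA2_plus_succ : forall u v : pterm G Num,
    PA2_axiom (peq (PPlus u (PSucc v)) (PSucc (PPlus u v)))
| PA2_mult_zero : forall u : pterm G Num, PA2_axiom (peq (PMult u PZero) PZero)
| PA2_mult_succ : forall u v : pterm G Num,
    PA2_axiom (peq (PMult u (PSucc v)) (PPlus (PMult u v) u))
| PA2_induction :
    PA2_axiom
      (All Set_
         (Imp (pin PZero (PVar VZ))
            (Imp (All Num
                    (Imp (pin (PVar VZ) (PVar (VS VZ)))
                         (pin (PSucc (PVar VZ)) (PVar (VS VZ)))))
               (All Num (pin (PVar VZ) (PVar (VS VZ)))))))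
(* [up shift] keeps the number variable of [A] and skips the new set variable *)
| PA2_comprehension : forall A : pform (Num :: G),
    PA2_axiom
      (Ex Set_ (All Num
         (Iff (pin (PVar VZ) (PVar (VS VZ)))
              (subst (up shift) A)))).

(** Intuitionistic logic with excluded middle for all formulas. *)
Definition PA2 : theory PAL :=
  {| axiom := fun G A => PA2_axiom A \/ LEM_axiom A;
     rule := fun _ _ _ => False |}.

(** * The interpretation

    A set variable becomes a variable for its characteristic function, and
    [t \in X] becomes [X t = 1]; sums and products are defined by the recursor. *)

Section Arithmetic.
  Context {G : list ty}.

  (* [fun r n => S r] as the combinator [s (k k) S] *)
  Definition hplus_step : hterm G (N ~> N ~> N) :=
    HConst (CS N N (N ~> N)) @@ (HConst (CK _ N) @@ HConst (CK N N))
      @@ HConst CSucc.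
  Definition hplus (u v : hterm G N) : hterm G N := hrec u hplus_step v.

  (* [fun r => r + u] as the combinator [s (s R (k hplus_step)) (k u)] *)
  Definition hplus_flip (u : hterm G N) : hterm G (N ~> N) :=
    HConst (CS N N N)
      @@ (HConst (CS N (N ~> N ~> N) (N ~> N)) @@ HConst (CRec N)
            @@ (HConst (CK _ N) @@ hplus_step))
      @@ (HConst (CK N N) @@ u).
  (* [fun r n => r + u] *)
  Definition hmult_step (u : hterm G N) : hterm G (N ~> N ~> N) :=
    HConst (CS N N (N ~> N)) @@ (HConst (CK _ N) @@ HConst (CK N N))
      @@ hplus_flip u.
  Definition hmult (u v : hterm G N) : hterm G N := hrec hzero (hmult_step u) v.
End Arithmetic.

Definition tr_sort (s : psort) : ty :=
  match s with Num => N | Set_ => N ~> N end.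

Fixpoint tr_var {G : list psort} {s} (v : var G s) :
  var (map tr_sort G) (tr_sort s) :=
  match v in var G s return var (map tr_sort G) (tr_sort s) with
  | VZ => VZ
  | VS w => VS (tr_var w)
  end.

Fixpoint tr_term {G : list psort} {s} (u : pterm G s) :
  hterm (map tr_sort G) (tr_sort s) :=
  match u in pterm _ s return hterm (map tr_sort G) (tr_sort s) with
  | PVar v => HVar (tr_var v)
  | PZero => hzero
  | PSucc a => hsucc (tr_term a)
  | PPlus a b => hplus (tr_term a) (tr_term b)
  | PMult a b => hmult (tr_term a) (tr_term b)
  end.

Definition tr_atom {G : list psort} (a : patom G) : hform (map tr_sort G) :=
  match a with
  | PEq u v => Eq (tr_term u) (tr_term v)
  | PIn u X => Eq (tr_term X @@ tr_term u) hone
  end.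

Fixpoint tr {G : list psort} (A : pform G) : hform (map tr_sort G) :=
  match A with
  | Atom a => tr_atom a
  | Bot => Bot
  | And A B => And (tr A) (tr B)
  | Or A B => Or (tr A) (tr B)
  | Imp A B => Imp (tr A) (tr B)
  | All s A => All (tr_sort s) (tr A)
  | Ex s A => Ex (tr_sort s) (tr A)
  end.

Definition PA2_interpreted_in (T : theory HAL) : Prop :=
  forall (G : list psort) (A : pform G), theorem_of PA2 A -> theorem_of T (tr A).

(** Impredicativity: every formula with a number variable, without restriction
    on the types of its quantifiers (in particular [N ~> N], the type of the
    characteristic functions of the sets of numbers) or of its parameters,
    defines a set of numbers by a characteristic function. *)
Definition impredicative (T : theory HAL) : Prop :=
  forall (G : list ty) (A : hform (N :: G)),
    theorem_of T
      (Ex (N ~> N) (All N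
         (Iff (Eq (HVar (VS VZ) @@ HVar VZ) hone)
              (subst (up shift) A)))).

(* Main.v *)
(** Excluded middle turns [A(x)] into the functional relation
    [(A(x) /\ y = 1) \/ (~ A(x) /\ y = 0)], and the rule of unique choice then
    yields the characteristic function of [{x | A(x)}]: full comprehension.  The
    other axioms of [PA2] become theorems of [HAomega], and the translation
    commutes with substitution, hence with every rule of logic. *)
From Stdlib Require Import List Setoid Morphisms.
Import ListNotations.
Require Import Defs.

Set Implicit Arguments.

(** The context index is generalised and [P] rebound in the return clause, so the case split on a
    variable needs no equality proofs between contexts. *)
Lemma var_case (S : Type) (t : S) (G : list S)
  (P : forall s, var (t :: G) s -> Prop) :
  P t VZ -> (forall s (w : var G s), P s (VS w)) ->
  forall s (v : var (t :: G) s), P s v.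
Proof.
  intros HZ HS s v.
  refine (match v as v' in var G' s' return
    match G' return var G' s' -> Prop with
    | [] => fun _ => True
    | t' :: G0 => fun v' => forall P : forall s, var (t' :: G0) s -> Prop,
        P t' VZ -> (forall s (w : var G0 s), P s (VS w)) -> P s' v'
    end v' with
    | VZ => fun P HZ _ => HZ
    | VS w => fun P _ HS => HS _ w
    end P HZ HS).
Qed.

(** * Substitution in [HAomega] *)

(** The composite is a third substitution [h] tied to [f] and [g] pointwise: substitutions are
    functions, and no extensionality is assumed. Pointwise equations also pass under binders. *)
Lemma hsubst_hsubst (G D E : list ty) (f : forall s, var G s -> hterm D s)
  (g : forall s, var D s -> hterm E s) (h : forall s, var G s -> hterm E s) :
  (forall s v, hsubst g (f s v) = h s v) ->
  forall s (u : hterm G s), hsubst g (hsubst f u) = hsubst h u.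
Proof.
  intros Hfg s u; induction u as [s v|s c|s t a IHa b IHb]; simpl.
  - apply Hfg.
  - reflexivity.
  - now rewrite IHa, IHb.
Qed.

Lemma up_comp (G D E : list ty) (t : ty) (f : sub (L := HAL) G D)
  (g : sub (L := HAL) D E) (h : sub (L := HAL) G E) :
  (forall s v, hsubst g (f s v) = h s v) ->
  forall s (v : var (t :: G) s), hsubst (up g) (up f v) = up h v.
Proof.
  intros Hfg; apply var_case; [reflexivity|intros s w].
  cbn -[hsubst]; rewrite <- Hfg.
  (* Shifting and then applying [up g] is the same as applying [g] and then shifting. *)
  now rewrite !(@hsubst_hsubst _ _ _ _ _
    (fun s v => hsubst (shift (L := HAL)) (g s v))).
Qed.

Lemma subst_subst (G : list ty) (A : hform G) :
  forall (D E : list ty) (f : sub G D) (g : sub D E) (h : sub G E),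
  (forall s v, hsubst g (f s v) = h s v) ->
  subst g (subst f A) = subst h A.
Proof.
  induction A as [G [s u v]| |G A IHA B IHB|G A IHA B IHB|G A IHA B IHB
    |G s A IHA|G s A IHA]; intros D E f g h Hfg; simpl.
  - now rewrite !(@hsubst_hsubst _ _ _ _ _ h).
  - reflexivity.
  - now rewrite (IHA _ _ _ _ h), (IHB _ _ _ _ h).
  - now rewrite (IHA _ _ _ _ h), (IHB _ _ _ _ h).
  - now rewrite (IHA _ _ _ _ h), (IHB _ _ _ _ h).
  - now rewrite (IHA _ _ _ _ (up h)) by now apply up_comp.
  - now rewrite (IHA _ _ _ _ (up h)) by now apply up_comp.
Qed.

Lemma hsubst_id (G : list ty) (f : forall s, var G s -> hterm G s) :
  (forall s v, f s v = HVar v) -> forall s (u : hterm G s), hsubst f u = u.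
Proof.
  intros Hf s u; induction u as [s v|s c|s t a IHa b IHb]; simpl.
  - apply Hf.
  - reflexivity.
  - now rewrite IHa, IHb.
Qed.

Lemma up_id (G : list ty) (t : ty) (f : sub (L := HAL) G G) :
  (forall s v, f s v = HVar v) ->
  forall s (v : var (t :: G) s), up f v = HVar v.
Proof.
  intros Hf; apply var_case; [reflexivity|intros s w].
  cbn -[hsubst]; now rewrite Hf.
Qed.

Lemma subst_id (G : list ty) (A : hform G) :
  forall f : sub G G, (forall s v, f s v = HVar v) -> subst f A = A.
Proof.
  induction A as [G [s u v]| |G A IHA B IHB|G A IHA B IHB|G A IHA B IHB
    |G s A IHA|G s A IHA]; intros f Hf; simpl.
  - now rewrite !hsubst_id.
  - reflexivity.
  - now rewrite IHA, IHB.
  - now rewrite IHA, IHB.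
  - now rewrite IHA, IHB.
  - now rewrite IHA by now apply up_id.
  - now rewrite IHA by now apply up_id.
Qed.

(** [up shift] skips index 1 and the instantiation merges index 0 with it, so the composite is the
    identity. An eigenvariable can thus serve as its own instance in [Ex_mono] and [All_mono]. *)
Lemma inst_up_shift (G : list ty) (t : ty) (A : hform (t :: G)) :
  inst (subst (up (shift (t := t))) A) (HVar VZ) = A.
Proof.
  unfold inst; rewrite (@subst_subst _ A _ _ _ _ (@ids HAL (t :: G))).
  - now apply subst_id.
  - now apply var_case.
Qed.

Lemma subst_scons_wk (G D : list ty) (t : ty) (A : hform G) (u : hterm D t)
  (f : sub (L := HAL) G D) :
  subst (scons u f) (wk A) = subst f A.
Proof. now apply subst_subst. Qed.

(** * Derived rules *)

Lemma Ex_mono (T : theory HAL) (G : list ty) (H : list (hform G)) (t : ty)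
  (A B : hform (t :: G)) :
  proves T (A :: map wk H) B -> proves T H (Ex t A) -> proves T H (Ex t B).
Proof.
  intros HAB HA; apply (PExE (A := A)); [exact HA|].
  apply PExI with (u := HVar VZ : term HAL _ t).
  change (proves T (A :: map wk H) (inst (subst (up shift) B) (HVar VZ))).
  now rewrite inst_up_shift.
Qed.

Lemma All_mono (T : theory HAL) (G : list ty) (H : list (hform G)) (t : ty)
  (A B : hform (t :: G)) :
  In (All t A) H ->
  proves T (A :: map wk H) B -> proves T H (All t B).
Proof.
  intros HA HAB; apply PAllI.
  apply PImpE with (A := A); [now apply PImpI|].
  rewrite <- (inst_up_shift A).
  apply PAllE, PHyp.
  exact (in_map (wk (t := t)) _ _ HA).
Qed.

(** * Equational reasoning inside formal derivations *)

Notation T := HAomega_iRC_LEM.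

Lemma HA_theorem (G : list ty) (H : list (hform G)) (A : hform G) :
  HA_axiom A -> proves T H A.
Proof. intros HA; apply PAxiom; now left. Qed.

Lemma LEM (G : list ty) (H : list (hform G)) (A : hform G) :
  proves T H (Or A (Not A)).
Proof. apply PAxiom; right; constructor. Qed.

(** Naming provable equality as a relation makes [rewrite] and [transitivity] available inside
    derivations. Application is the only compound term former, so one congruence instance
    suffices. *)
Definition heq (G : list ty) (H : list (hform G)) (s : ty) (u v : hterm G s) :
  Prop := proves T H (Eq u v).
Arguments heq {G} H {s} u v.

#[export] Instance heq_equivalence (G : list ty) (H : list (hform G)) (s : ty) :
  Equivalence (@heq G H s).
Proof.
  split.
  - intros u; apply HA_theorem; constructor.
  - intros u v Huv; eapply PImpE; [apply HA_theorem, HA_sym|exact Huv].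
  - intros u v w Huv Hvw; eapply PImpE; [|exact Hvw].
    eapply PImpE; [apply HA_theorem, HA_trans|exact Huv].
Qed.

#[export] Instance HApp_heq (G : list ty) (H : list (hform G)) (s t : ty) :
  Proper (heq H ==> heq H ==> heq H) (@HApp G s t).
Proof.
  intros f g Hfg u v Huv; eapply PImpE; [|exact Huv].
  eapply PImpE; [apply HA_theorem, HA_congr|exact Hfg].
Qed.

Section Equations.
  Context {G : list ty} (H : list (hform G)).

  Lemma heq_k s t (a : hterm G s) (b : hterm G t) :
    heq H (HConst (CK s t) @@ a @@ b) a.
  Proof. apply HA_theorem; constructor. Qed.

  Lemma heq_s r s t (a : hterm G (r ~> s ~> t)) (b : hterm G (r ~> s))
    (c : hterm G r) :
    heq H (HConst (CS r s t) @@ a @@ b @@ c) (a @@ c @@ (b @@ c)).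
  Proof. apply HA_theorem; constructor. Qed.

  Lemma heq_rec_zero s (a : hterm G s) b : heq H (hrec a b hzero) a.
  Proof. apply HA_theorem; constructor. Qed.

  Lemma heq_rec_succ s (a : hterm G s) b u :
    heq H (hrec a b (hsucc u)) (b @@ hrec a b u @@ u).
  Proof. apply HA_theorem; constructor. Qed.

  Lemma hplus_succ (u v : hterm G N) :
    heq H (hplus u (hsucc v)) (hsucc (hplus u v)).
  Proof.
    unfold hplus; rewrite heq_rec_succ; unfold hplus_step at 1.
    now rewrite heq_s, heq_k, heq_k.
  Qed.

  Lemma hmult_succ (u v : hterm G N) :
    heq H (hmult u (hsucc v)) (hplus (hmult u v) u).
  Proof.
    unfold hmult; rewrite heq_rec_succ; unfold hmult_step at 1, hplus_flip.
    (* First [s (k k)] drops the counter; then the two [s] of [hplus_flip] route the running product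
       into the base case of the recursor. *)
    now rewrite heq_s, heq_k, heq_k, heq_s, heq_s, !heq_k.
  Qed.

  Lemma heq_one_zero (u : hterm G N) (A : hform G) :
    heq H u hone -> heq H u hzero -> proves T H A.
  Proof.
    intros H1 H0; apply PBotE; eapply PImpE.
    - apply HA_theorem, (HA_succ_zero hzero).
    - change (heq H hone hzero); now rewrite <- H1.
  Qed.
End Equations.

Ltac hyp := apply PHyp; simpl; tauto.

(** * Comprehension *)

(** The value is a term, so one formula serves both for the graph, with [u] a variable, and for the
    chosen function, with [u] an application. *)
Definition char_graph (G : list ty) (A : hform G) (u : hterm G N) : hform G :=
  Or (And A (Eq u hone)) (And (Not A) (Eq u hzero)).

Lemma char_graph_unique (G : list ty) (H : list (hform G)) (A : hform G)
  (u v : hterm G N) :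
  proves T H (Imp (And (char_graph A u) (char_graph A v)) (Eq u v)).
Proof.
  apply PImpI.
  apply POrE with (A := And A (Eq u hone)) (B := And (Not A) (Eq u hzero));
    [eapply PAndE1; hyp| |];
    (apply POrE with (A := And A (Eq v hone)) (B := And (Not A) (Eq v hzero));
      [eapply PAndE2; hyp| |]);
    match goal with |- proves _ ?K _ => change (heq K u v) end.
  - transitivity (@hone G); [|symmetry]; eapply PAndE2; hyp.
  - apply PBotE; apply PImpE with (A := A); eapply PAndE1; hyp.
  - apply PBotE; apply PImpE with (A := A); eapply PAndE1; hyp.
  - transitivity (@hzero G); [|symmetry]; eapply PAndE2; hyp.
Qed.

(** Excluded middle is an axiom here, not an assumption, so this premise has no open hypotheses, as
    the rule of unique choice demands. *)
Lemma char_graph_ExUnique (G : list ty) (A : hform (N :: G)) :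
  theorem_of T (All N (ExUnique (char_graph (wk A) (HVar VZ)))).
Proof.
  apply PAllI, PAndI.
  (* Instantiating [y] in [wk A] leaves [subst ids A], so the case split is made on that form. *)
  - apply POrE with (A := subst ids A) (B := Not (subst ids A)); [apply LEM| |].
    + apply PExI with (u := hone); cbn -[subst]; apply POrI1, PAndI.
      * rewrite subst_scons_wk; hyp.
      * apply HA_theorem, HA_refl.
    + apply PExI with (u := hzero); cbn -[subst]; apply POrI2, PAndI.
      * cbn; rewrite subst_scons_wk; hyp.
      * apply HA_theorem, HA_refl.
  - apply PAllI, PAllI; cbn.
    rewrite !subst_scons_wk; apply char_graph_unique.
Qed.

Lemma char_graph_iff (G : list ty) (H : list (hform G)) (A : hform G)
  (u : hterm G N) :
  In (char_graph A u) H -> proves T H (Iff (Eq u hone) A).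
Proof.
  intros HA; apply PAndI; apply PImpI;
    (apply POrE with (A := And A (Eq u hone)) (B := And (Not A) (Eq u hzero));
      [apply PHyp; now right| |]).
  - eapply PAndE1; hyp.
  - apply heq_one_zero with (u := u); [hyp|eapply PAndE2; hyp].
  - eapply PAndE2; hyp.
  - apply PBotE; apply PImpE with (A := A); [eapply PAndE1|]; hyp.
Qed.

(** Covering all formulas of the target language, this yields both the translated comprehension
    axiom and impredicativity. *)
Lemma comprehension (G : list ty) (H : list (hform G)) (A : hform (N :: G)) :
  proves T H
    (Ex (N ~> N) (All N
       (Iff (Eq (HVar (VS VZ) @@ HVar VZ) hone) (subst (up shift) A)))).
Proof.
  (* The graph with [f x] in place of [y], which is what the rule concludes. *)
  set (B := All N (char_graph (subst (up shift) A)
    (HVar (VS VZ) @@ HVar VZ)) : hform ((N ~> N) :: G)).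
  apply Ex_mono with (A := B).
  - apply All_mono with (1 := or_introl eq_refl), char_graph_iff.
    now left.
  - eapply PRule; [|apply char_graph_ExUnique with (A := A)].
    assert (E := iRC_intro (char_graph (wk A) (HVar VZ))).
    cbn in E; rewrite subst_scons_wk in E.
    replace (subst _ A) with (subst (up (shift (L := HAL) (t := N ~> N))) A)
      in E; [exact E|].
    (* Inserting an identity turns the comparison of two pointwise equal substitutions into an
       instance of [subst_subst]. *)
    rewrite <- (@subst_id _ A (@ids HAL _)) at 2 by easy.
    symmetry; apply subst_subst; now apply var_case.
Qed.

(** * Soundness of the translation *)

Lemma tr_psubst (G D : list psort) (f : forall s, var G s -> pterm D s)
  (g : forall s, var (map tr_sort G) s -> hterm (map tr_sort D) s) :
  (forall s v, g _ (tr_var v) = tr_term (f s v)) ->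
  forall s (u : pterm G s), tr_term (psubst f u) = hsubst g (tr_term u).
Proof.
  intros Hfg s u.
  induction u as [s v| |a IHa|a IHa b IHb|a IHa b IHb]; simpl.
  - now rewrite Hfg.
  - reflexivity.
  - now rewrite IHa.
  - now rewrite IHa, IHb.
  - now rewrite IHa, IHb.
Qed.

Lemma tr_up (G D : list psort) (t : psort) (f : sub (L := PAL) G D)
  (g : sub (L := HAL) (map tr_sort G) (map tr_sort D)) :
  (forall s v, g _ (tr_var v) = tr_term (f s v)) ->
  forall s (v : var (t :: G) s), up g (tr_var v) = tr_term (up f v).
Proof.
  intros Hfg; apply var_case; [reflexivity|intros s w].
  cbn -[hsubst psubst]; rewrite Hfg.
  now rewrite (@tr_psubst D (t :: D) _ (shift (L := HAL))).
Qed.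

Lemma tr_subst (G : list psort) (A : pform G) :
  forall (D : list psort) (f : sub G D)
    (g : sub (map tr_sort G) (map tr_sort D)),
  (forall s v, g _ (tr_var v) = tr_term (f s v)) ->
  tr (subst f A) = subst g (tr A).
Proof.
  induction A as [G [u v|u v]| |G A IHA B IHB|G A IHA B IHB|G A IHA B IHB
    |G s A IHA|G s A IHA]; intros D f g Hfg; simpl.
  - now rewrite !(tr_psubst _ _ Hfg).
  - now rewrite !(tr_psubst _ _ Hfg).
  - reflexivity.
  - now rewrite (IHA _ _ g), (IHB _ _ g).
  - now rewrite (IHA _ _ g), (IHB _ _ g).
  - now rewrite (IHA _ _ g), (IHB _ _ g).
  - f_equal; exact (IHA (s :: D) _ _ (tr_up _ _ Hfg)).
  - f_equal; exact (IHA (s :: D) _ _ (tr_up _ _ Hfg)).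
Qed.

Lemma tr_wk (G : list psort) (t : psort) (A : pform G) :
  tr (wk (t := t) A) = wk (tr A).
Proof. now apply tr_subst. Qed.

Lemma tr_inst (G : list psort) (t : psort) (A : pform (t :: G))
  (u : pterm G t) :
  tr (inst A u) = inst (tr A) (tr_term u).
Proof. apply tr_subst; now apply var_case. Qed.

Lemma tr_axiom (G : list psort) (H : list (hform (map tr_sort G)))
  (A : pform G) :
  PA2_axiom A -> proves T H (tr A).
Proof.
  intros [u|u v|u v w|u v|u u' v v'|u u' v v'|u v X|u|u v|u|u v|u|u v| |B];
    cbn [tr tr_atom peq pin tr_term Not];
    repeat apply PImpI;
    try match goal with |- proves _ ?K (Eq ?a ?b) => change (heq K a b) end.
  - reflexivity.
  - symmetry; hyp.
  - transitivity (tr_term v); hyp.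
  - unfold hsucc; apply HApp_heq; [reflexivity|hyp].
  - unfold hplus, hrec; repeat apply HApp_heq; reflexivity || hyp.
  (* The left factor sits inside the step combinator, so congruence has to descend into it. *)
  - unfold hmult, hmult_step, hplus_flip, hrec; repeat apply HApp_heq;
      reflexivity || hyp.
  - transitivity (tr_term X @@ tr_term u); [|hyp].
    apply HApp_heq; [reflexivity|symmetry; hyp].
  - eapply PImpE; [apply HA_theorem, HA_succ_zero|hyp].
  - apply PImpE with (A := Eq (hsucc (tr_term u)) (hsucc (tr_term v)));
      [apply HA_theorem, HA_succ_inj|hyp].
  - apply heq_rec_zero.
  - apply hplus_succ.
  - apply heq_rec_zero.
  - apply hmult_succ.
  - apply PAllI, HA_theorem.
    (* Set induction is the scheme at the formula [X x = 1]. *)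
    exact (HA_induction (Eq (HVar (VS VZ) @@ HVar VZ) hone)).
  - assert (E : tr (subst (up (shift (t := Set_))) B)
              = subst (up (shift (L := HAL) (t := N ~> N))) (tr B)).
    { apply (@tr_subst _ B (Num :: Set_ :: G)).
      now apply (@tr_up G (Set_ :: G) Num). }
    cbn in E |- *; rewrite E; apply comprehension.
Qed.

Lemma tr_sound (G : list psort) (H : list (pform G)) (A : pform G) :
  proves PA2 H A -> proves T (map tr H) (tr A).
Proof.
  (* The eigenvariable rules weaken all hypotheses at once. *)
  assert (map_wk : forall G (t : psort) (H : list (pform G)),
    map tr (map (wk (t := t)) H) = map (wk (t := tr_sort t)) (map tr H)).
  { intros G' t K; rewrite !map_map; apply map_ext; intros B; apply tr_wk. }
  (* [PA2] has no extra rules, so that case is empty; unique choice enters only through the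
     comprehension axiom. *)
  induction 1 as [G H A HA|G H A [HA|[B]]|G H A B [] _ _| | | | | | | | | |
    G H s A _ IH|G H s A u _ IH|G H s A u _ IH|G H s A C _ IHA _ IHC]; simpl in *.
  - now apply PHyp, in_map.
  - now apply tr_axiom.
  - apply LEM.
  - now apply PBotE.
  - now apply PAndI.
  - eapply PAndE1; eassumption.
  - eapply PAndE2; eassumption.
  - now apply POrI1.
  - now apply POrI2.
  - eapply POrE; eassumption.
  - now apply PImpI.
  - eapply PImpE; eassumption.
  - apply PAllI; now rewrite <- map_wk.
  - rewrite tr_inst; now apply PAllE.
  - rewrite tr_inst in IH; eapply PExI; exact IH.
  - rewrite map_wk, tr_wk in IHC; eapply PExE; eassumption.
Qed.

Theorem corollary4p4 :
  PA2_interpreted_in HAomega_iRC_LEM /\ impredicative HAomega_iRC_LEM.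
Proof.
  split; intros G A.
  - intros HA; exact (tr_sound HA).
  - apply comprehension.
Qed.
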